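(* For each integer $n \geq 0$, there exists a configuration $x \in \{0,1\}^{\mathbb{Z}^2}$ with $g^{-n}(x) \neq \emptyset$ and $g^{-(n+1)}(x) = \emptyset$, where $g$ is the Game of Life cellular automaton.
   Context: The Game of Life is the map $g : \{0,1\}^{\mathbb{Z}^2} \to \{0,1\}^{\mathbb{Z}^2}$ defined as follows. Let $K = \{-1,0,1\}^2 \setminus \{(0,0)\}$. For $x \in \{0,1\}^{\mathbb{Z}^2}$ and $\vec v \in \mathbb{Z}^2$, put $s = \sum_{\vec u \in K} x_{\vec v + \vec u}$. Then $g(x)_{\vec v} = 1$ if and only if ($x_{\vec v} = 0$ and $s = 3$) or ($x_{\vec v} = 1$ and $s \in \{2,3\}$). Here $g^{-n}(x) = \{ y \in \{0,1\}^{\mathbb{Z}^2} : g^n(y) = x\}$. *)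

(* Defs.v *)
From mathcomp Require Import all_boot all_order all_algebra.
From mathcomp Require Import boolp classical_sets.

Set Implicit Arguments.
Unset Strict Implicit.
Unset Printing Implicit Defensive.

(* the symbols 0 and 1 are false and true *)
Definition config : Type := int * int -> bool.

(* {-1,0,1}^2 \ {(0,0)}, without repetition *)
Definition moore : seq (int * int) :=
  [seq u <- [seq (i, j) | i <- [:: -1; 0; 1]%R, j <- [:: -1; 0; 1]%R]
  | u != (0, 0)%R].

Definition live_neighbours (x : config) (v : int * int) : nat :=
  \sum_(u <- moore) x (v + u)%R.

Definition life (x : config) : config := fun v =>
  let s := live_neighbours x v in
  (~~ x v && (s == 3)) || (x v && (s \in [:: 2; 3])).

(* Main.v *)
(* Let y be the still life of period (6, 3) whose rows are ..oooo / oo.o.. / o..... ("kynnos",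
   found by Salo and Torma). Call a set H of cells self-forcing when every configuration whose
   image agrees with y on H agrees itself with y on H. The whole plane is self-forcing: record, for
   each of the 18 phases of y, the patterns that a preimage may show in a 5 x 4 window, and discard
   those with no compatible pattern in a neighbouring window; eventually only y survives, after
   boundedly many steps, so that agreement of the image with y on a large ball forces the centre.
   Suitable half-planes on three sides of a triangle are self-forcing too, by the same computation
   carried out along their boundary lines.

   Suppose now that every configuration with an n-th preimage has an (n+1)-st one. Fix a large
   triangle T and consider the configurations that have an n-th preimage and agree with y outside
   T. There are finitely many, and each is the image of another one, so all of them are periodic
   under life, and life is injective on them. But placing in a large empty hole of y either nothing
   or a diagonal segment of 2n+1 cells, which loses its two end cells at each step, yields two
   configurations that differ after n steps and coincide after n+1. *)

Require Import Defs.
From mathcomp Require Import all_boot all_order all_algebra.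
From mathcomp Require Import boolp classical_sets.
From mathcomp Require Import zify.

Set Implicit Arguments.
Unset Strict Implicit.
Unset Printing Implicit Defensive.

Import GRing.Theory.

Section GameOfLife.

Local Open Scope ring_scope.

Notation point := (int * int)%type.

Implicit Types (x y : config) (u v w : point) (p : nat).

(** * The periodic still life and the local rule read through windows *)

Definition phase v : nat := (`|(v.1 %% 6)%Z| + 6 * `|(v.2 %% 3)%Z|)%N.

Definition rep p : point := (Posz (p %% 6)%N, Posz (p %/ 6)%N).

(* Rows ..oooo / oo.o.. / o..... , repeated with period (6, 3). *)
Definition cell p : bool := p \in [:: 2; 3; 4; 5; 6; 7; 9; 12]%N.

Definition agar : config := fun v => cell (phase v).

Lemma phase_lt v : (phase v < 18)%N.
Proof. by rewrite /phase; lia. Qed.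

Lemma phaseD v u : phase (v + u) = phase (rep (phase v) + u).
Proof. by case: v u => [v1 v2] [u1 u2]; rewrite /phase /rep /=; lia. Qed.

Lemma phase_period v u :
  (u.1 %% 6)%Z = 0 -> (u.2 %% 3)%Z = 0 -> phase (v + u) = phase v.
Proof.
by case: v u => [v1 v2] [u1 u2] /= h1 h2; rewrite /phase /=; lia.
Qed.

Definition read x v (W : seq point) : bitseq := [seq x (v + w) | w <- W].

Lemma read_mask x v m W : mask m (read x v W) = read x v (mask m W).
Proof. by rewrite /read map_mask. Qed.

Lemma read_shift x v u W : read x v [seq w + u | w <- W] = read x (v + u) W.
Proof. by rewrite /read -map_comp; apply: eq_map => w /=; rewrite addrA addrAC. Qed.

Definition rect (a b c d : int) : seq point :=
  [seq (a + Posz i, c + Posz j) | i <- iota 0 `|b - a|.+1, j <- iota 0 `|d - c|.+1].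

Definition block3 := rect (-1) 1 (-1) 1.

Definition rule (l : bitseq) : bool :=
  let c := nth false l 4 in
  let s := sumn [seq nat_of_bool b | b <- take 4 l ++ drop 5 l] in
  (~~ c && (s == 3)) || (c && (s \in [:: 2; 3])).

Lemma lifeE x v : life x v = rule (read x v block3).
Proof.
have mE : moore = map (nth 0 block3) [:: 0; 1; 2; 3; 5; 6; 7; 8]%N by [].
rewrite /life /live_neighbours mE !big_cons big_nil /rule /=.
rewrite (_ : v + (-1 + 1, -1 + 1) = v) //.
by case: v => a b; congr (_, _); rewrite addr0.
Qed.

Lemma life_shift x v w : life (fun u => x (u + w)) v = life x (v + w).
Proof.
have lnE : live_neighbours (fun u => x (u + w)) v = live_neighbours x (v + w).
  by apply: eq_bigr => u _; rewrite addrAC.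
by rewrite /life lnE.
Qed.

Lemma life_agar : life agar = agar.
Proof.
apply/funext => v; rewrite lifeE.
have -> : read agar v block3 = read agar (rep (phase v)) block3.
  by apply: eq_map => w; rewrite /agar phaseD.
have : all (fun p => rule (read agar (rep p) block3) == cell p) (iota 0 18).
  by vm_compute.
by move/allP/(_ (phase v)); rewrite mem_iota phase_lt => /(_ isT)/eqP.
Qed.

(** * Tries as sets of binary words *)

(* Sets of words; [All] contains the words of any length. *)
Inductive trie := Emp | All | Br of trie & trie.

Fixpoint has_word (t : trie) (l : bitseq) : bool :=
  match t, l with
  | All, _ => true
  | Br a b, c :: l' => has_word (if c then b else a) l'
  | _, _ => false
  end.

Definition br (a b : trie) : trie :=
  match a, b with
  | Emp, Emp => Emp
  | All, All => All
  | _, _ => Br a b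
  end.

Lemma has_br a b c l : has_word (br a b) (c :: l) = has_word (if c then b else a) l.
Proof. by case: a b c => [||a1 a2] [||b1 b2] []. Qed.

Fixpoint union (s t : trie) : trie :=
  match s, t with
  | Emp, _ => t
  | _, Emp => s
  | All, _ | _, All => All
  | Br a b, Br c d => br (union a c) (union b d)
  end.

Lemma has_union s t l : has_word s l || has_word t l -> has_word (union s t) l.
Proof.
elim: s t l => [||a IHa b IHb] [||c d] [|e l] //=; rewrite ?orbF //.
by rewrite has_br; case: e => [/IHb|/IHa].
Qed.

(* Existential quantification over the letters not selected by [m]. *)
Fixpoint proj (m : bitseq) (t : trie) : trie :=
  match t, m with
  | Emp, _ => Emp
  | All, _ | Br _ _, [::] => All
  | Br a b, c :: m' =>
      if c then br (proj m' a) (proj m' b) else union (proj m' a) (proj m' b)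
  end.

(** Like the other trie operations, [proj] may enlarge the set, for instance where the mask runs
    out. Soundness means that no possible word is ever lost. *)
Lemma has_proj m t l : has_word t l -> has_word (proj m t) (mask m l).
Proof.
elim: m t l => [|[] m IHm] [||a b] [|d l] //= h; first by rewrite has_br; case: d h => /IHm.
by apply: has_union; case: d h => /IHm ->; rewrite ?orbT.
Qed.

Definition kids (t : trie) : trie * trie :=
  match t with Br a b => (a, b) | _ => (t, t) end.

(* The words of [t] whose letters selected by [m] spell a word of [s]. *)
Fixpoint restrict (m : bitseq) (t s : trie) : trie :=
  match t, s, m with
  | Emp, _, _ | _, Emp, _ => Emp
  | _, All, _ | _, _, [::] => t
  | _, _, c :: m' =>
      let: (a, b) := kids t in
      if c then let: (d, e) := kids s in br (restrict m' a d) (restrict m' b e)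
      else br (restrict m' a s) (restrict m' b s)
  end.

Lemma has_restrict m t s l :
  has_word t l -> has_word s (mask m l) -> has_word (restrict m t s) l.
Proof.
elim: m t s l => [|c m IHm] t s l; first by case: t s => [||a b] [||d e].
case: l => [|f l]; first by case: t s => [||a b] [||d e].
case: t s => [||a b] [||d e] //; case: c => //= h1 h2; rewrite has_br.
- by case: f h2 {h1} => h2; apply: IHm.
- by case: f h2 {h1} => h2; apply: IHm.
- by case: f h1 h2 => h1 h2; apply: IHm.
- by case: f h1 h2 => h1 h2; apply: IHm.
Qed.

Fixpoint tabulate (n : nat) (f : bitseq -> bool) : trie :=
  match n with
  | 0 => if f [::] then All else Emp
  | n'.+1 => br (tabulate n' (fun l => f (false :: l)))
                (tabulate n' (fun l => f (true :: l)))
  end.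

Lemma has_tabulate l (f : bitseq -> bool) : f l -> has_word (tabulate (size l) f) l.
Proof. by elim: l f => [|[] l IHl] f h /=; rewrite ?h // has_br IHl. Qed.

(** * Elimination of patterns in overlapping windows *)

Definition live_blocks := tabulate 9 rule.
Definition dead_blocks := tabulate 9 (fun l => ~~ rule l).
Definition blocks (b : bool) : trie := if b then live_blocks else dead_blocks.

Lemma has_blocks x v : has_word (blocks (life x v)) (read x v block3).
Proof.
rewrite lifeE; case h: (rule _).
- exact: (@has_tabulate (read x v block3) rule h).
- exact: (@has_tabulate (read x v block3) (fun l => ~~ rule l) (negbT h)).
Qed.

Definition overlap (W V : seq point) u : bitseq * bitseq :=
  ([seq w - u \in V | w <- W], [seq w + u \in W | w <- V]).

(* Whether [W] and the translate of [V] by [u] list their common cells in the same order. *)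
Definition aligned W V u (m := overlap W V u) : bool :=
  mask m.1 W == [seq w + u | w <- mask m.2 V].

Definition links W V us : seq (point * (bitseq * bitseq)) :=
  [seq (u, overlap W V u) | u <- us & aligned W V u].

(** One step of arc consistency: the patterns at [v] and at [v + u] come from the same
    configuration, so they agree on the common cells. *)
Lemma has_cut x v u W V t s (m := overlap W V u) : aligned W V u ->
  has_word t (read x v W) -> has_word s (read x (v + u) V) ->
  has_word (restrict m.1 t (proj m.2 s)) (read x v W).
Proof.
move=> /eqP mE ht hs; apply: has_restrict => //.
by rewrite read_mask mE read_shift -read_mask; apply: has_proj.
Qed.

Definition job : Type := (nat * nat * (bitseq * bitseq))%type.

Definition jobs W V us (ps : seq nat) : seq job :=
  let ls := links W V us in
  [seq (p, phase (rep p + l.1), l.2) | p <- ps, l <- ls].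

Definition cut (S T : seq trie) (j : job) : seq trie :=
  let: (p, q, m) := j in
  set_nth Emp T p (restrict m.1 (nth Emp T p) (proj m.2 (nth Emp S q))).

Definition extend S js : seq trie := foldl (cut S) (nseq 18 All) js.

Definition sweep js S : seq trie := foldl (fun T j => cut T T j) S js.

Section Soundness.

Variable ok : config -> nat -> point -> Prop.
Hypothesis ok_le : forall x k v, ok x k.+1 v -> ok x k v.

(** Here [k] is a locality budget, such as the radius in [near]. Each cut spends one unit, so a
    finite run of cuts needs only a finite budget. *)
Definition admits W S k : Prop :=
  forall x v, ok x k v -> has_word (nth Emp S (phase v)) (read x v W).

Lemma admits_le W S k : admits W S k -> admits W S k.+1.
Proof. by move=> h x v /ok_le; apply: h. Qed.

Variables (W V us : seq point) (ps : seq nat).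
Hypothesis ok_shift : forall x k v u, u \in us -> ok x k.+1 v -> ok x k (v + u).

Lemma admits_cut S T j k : j \in jobs W V us ps ->
  admits V S k -> admits W T k -> admits W (cut S T j) k.+1.
Proof.
case/allpairsP => -[p l] [_ /mapP[u]]; rewrite mem_filter => /andP[uP us_u] -> -> /=.
move=> hS hT x v okv; rewrite nth_set_nth /=; case: eqP => [<-|_]; last exact/hT/ok_le.
apply: has_cut uP _ _; first exact/hT/ok_le.
by rewrite -phaseD; apply/hS/ok_shift.
Qed.

Lemma admits_extend S k :
  admits V S k -> exists k', admits W (extend S (jobs W V us ps)) k'.
Proof.
move=> hS; have hT : admits W (nseq 18 All) k by move=> x v _; rewrite nth_nseq phase_lt.
rewrite /extend; move: (jobs _ _ _ _) (@admits_cut) => js step.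
suff: forall js' T k, {subset js' <= js} -> admits V S k -> admits W T k ->
    exists k', admits W (foldl (cut S) T js') k'.
  by move/(_ js _ k); apply.
elim=> {hS hT k} [|j js' IHjs] T k sub hS hT; first by exists k.
apply: (IHjs _ k.+1) => [i ijs||]; first by apply: sub; rewrite inE ijs orbT.
  exact: admits_le.
by apply: step hS hT; rewrite sub ?mem_head.
Qed.

End Soundness.

Lemma admits_sweeps ok W us ps S n :
  (forall x k v, ok x k.+1 v -> ok x k v) ->
  (forall x k v u, u \in us -> ok x k.+1 v -> ok x k (v + u)) ->
  (exists k, admits ok W S k) ->
  exists k, admits ok W (iter n (sweep (jobs W W us ps)) S) k.
Proof.
move=> ok_le ok_shift hS; elim: n => //= n {hS} [k].
rewrite {2}/sweep; move: (jobs _ _ _ _) (@admits_cut ok ok_le W W us ps ok_shift) => js step.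
suff: forall js' T k, {subset js' <= js} -> admits ok W T k ->
    exists k', admits ok W (foldl (fun T j => cut T T j) T js') k'.
  by move/(_ js _ k); apply.
elim=> {k} [|j js' IHjs] T k sub hT; first by exists k.
apply: (IHjs _ k.+1) => [i ijs|]; first by apply: sub; rewrite inE ijs orbT.
exact: step (sub _ (mem_head _ _)) (hT) (hT).
Qed.

(** The first conjunct makes sure that the base cell occurs in the window. An empty trie forces
    vacuously. *)
Definition forces W S p : bool :=
  let m := overlap W [:: 0] 0 in
  (mask m.1 W == [:: 0]) && ~~ has_word (proj m.1 (nth Emp S p)) [:: ~~ cell p].

Lemma forcesP ok W S k x v :
  admits ok W S k -> ok x k v -> forces W S (phase v) -> x v = agar v.
Proof.
move=> hS okv /andP[/eqP mE]; apply: contraNeq => xv.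
have -> : [:: ~~ cell (phase v)] = read x v [:: 0].
  by rewrite /read /= addr0; move: xv; rewrite /agar; case: (x v) (cell _) => [] [].
by rewrite -[X in read x v X]mE -read_mask; apply/has_proj/hS.
Qed.

(** * The whole plane is self-forcing *)

Definition near x k v : Prop :=
  forall u, (`|u.1| <= k)%N -> (`|u.2| <= k)%N -> life x (v + u) = agar (v + u).

Lemma near_le x k v : near x k.+1 v -> near x k v.
Proof. by move=> h u *; apply: h; lia. Qed.

Lemma near_shift x k v u :
  (`|u.1| <= 1)%N -> (`|u.2| <= 1)%N -> near x k.+1 v -> near x k (v + u).
Proof. by move=> u1 u2 h w w1 w2; rewrite -addrA; apply: h => /=; lia. Qed.

Definition phases := iota 0 18.

Lemma mem_phases v : phase v \in phases.
Proof. by rewrite mem_iota phase_lt. Qed.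

Definition axes : seq point := [:: (1, 0); (-1, 0); (0, 1); (0, -1)].

Definition block4 := rect (-1) 2 (-1) 2.
Definition block5 := rect (-1) 3 (-1) 2.

(** The windows grow from 3 x 3 through 4 x 4 to 5 x 4, so that each larger window starts from
    patterns already thinned out by the smaller one. *)
Definition tries3 :=
  iter 3 (sweep (jobs block3 block3 axes phases)) [seq blocks (cell p) | p <- phases].
Definition tries4 :=
  iter 3 (sweep (jobs block4 block4 axes phases))
    (extend tries3 (jobs block4 block3 (rect 0 1 0 1) phases)).
Definition tries5 :=
  iter 34 (sweep (jobs block5 block5 axes phases))
    (extend tries4 (jobs block5 block4 (rect 0 1 0 0) phases)).

Lemma tries5_forces : all (forces block5 tries5) phases.
Proof. by vm_compute. Qed.

Lemma agar_forced : exists k, forall x v, near x k v -> x v = agar v.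
Proof.
have step us : all (fun u => (`|u.1| <= 1)%N && (`|u.2| <= 1)%N) us ->
    forall x k v u, u \in us -> near x k.+1 v -> near x k (v + u).
  by move=> /allP us1 x k v u /us1/andP[u1 u2]; apply: near_shift.
have [k3 h3] : exists k, admits near block3 tries3 k.
  apply: admits_sweeps near_le (step _ _) _ => //.
  exists 0%N => x v h; rewrite (nth_map 0%N) ?size_iota ?phase_lt // nth_iota ?phase_lt // add0n.
  by rewrite -[cell _]/(agar v) -[v in agar v]addr0 -h // addr0; apply: has_blocks.
have [k4 h4] : exists k, admits near block4 tries4 k.
  apply: admits_sweeps near_le (step _ _) _ => //.
  by apply: admits_extend h3; [exact: near_le|exact: step].
have [k5 h5] : exists k, admits near block5 tries5 k.
  apply: admits_sweeps near_le (step _ _) _ => //.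
  by apply: admits_extend h4; [exact: near_le|exact: step].
exists k5 => x v h; apply: forcesP h5 h _.
by apply: (allP tries5_forces); apply: mem_phases.
Qed.

(** * Self-forcing half-planes *)

(* A periodic approximation of a half-plane: the cells [v] whose height does not exceed the
   threshold of their phase. *)
Record side := Side {
  slope : point;
  period : nat;
  threshold : seq int;
  window : seq point;
  along : point;
  inward : point }.

Implicit Type s : side.

Definition height s u : int := (slope s).1 * u.1 + (slope s).2 * u.2.

Definition within s (d : int) p : bool := d <= nth 0 (threshold s) p.

Definition inside s v : bool := within s (height s v) (phase v).

Lemma heightD s u v : height s (u + v) = height s u + height s v.
Proof. by rewrite /height /= !mulrDr addrACA. Qed.

Lemma heightN s u : height s (- u) = - height s u.
Proof. by rewrite /height /= !mulrN opprD. Qed.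

Definition letter (b : bool) : trie := if b then Br Emp All else Br All Emp.

(* Here [p] is the phase of the base cell of the window, which lies at height [l]; with [known] set,
   only the cells below height [l] are used. *)
Definition constrain s (l : int) p (known : bool) (tr : bool -> trie) t
    (lk : point * (bitseq * bitseq)) : trie :=
  let q := phase (rep p + lk.1) in
  let d := l + height s lk.1 in
  if within s d q && (known ==> (d < l)) then restrict lk.2.1 t (proj lk.2.2 (tr (cell q)))
  else t.

Definition seed s (ones blks : seq (point * (bitseq * bitseq))) (l : int) p : trie :=
  foldl (constrain s l p false blocks) (foldl (constrain s l p true letter) All ones) blks.

Definition online s (l : int) : seq nat :=
  [seq p <- phases | ((height s (rep p) - l) %% period s)%Z == 0].

Definition line s ones blks (l : int) : seq trie :=
  let W := window s in
  let ps := online s l in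
  iter 4 (sweep (jobs W W [:: along s; - along s] ps))
    [seq if p \in ps then seed s ones blks l p else All | p <- phases].

(** Only outermost cells, those whose height equals their threshold, are tested. A deeper cell is
    carried to such a position by a translation preserving the agar. *)
Definition self_forcing s : bool :=
  let W := window s in
  let ones := links W [:: 0] W in
  let blks := links W block3 W in
  all (fun l => let S := line s ones blks l in
    all (fun p => (nth 0 (threshold s) p == l) ==> forces W S p) (online s l))
    (undup (threshold s)).

(** The divisibility conditions make the height modulo [period] a function of the phase. The
    threshold of a phase lies in its residue class, so it is attained. *)
Definition well_formed s : bool :=
  [&& size (threshold s) == 18,
      all (fun d => `|d| <= 10)%N (threshold s),
      all (fun p => ((height s (rep p) - nth 0 (threshold s) p) %% period s)%Z == 0) phases,
      (`|(slope s).1| <= 1)%N, (`|(slope s).2| <= 1)%N, (0 < period s)%N,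
      (period s %| 6 * `|(slope s).1|)%N, (period s %| 3 * `|(slope s).2|)%N,
      height s (along s) == 0, height s (inward s) == - Posz (period s),
      ((inward s).1 %% 6)%Z == 0 & ((inward s).2 %% 3)%Z == 0].

Definition thresholds (f : nat -> nat -> int) : seq int :=
  [seq f (p %% 6)%N (p %/ 6)%N | p <- phases].

(** As the first coordinate is fixed modulo 6 by the phase, these thresholds describe exactly the
    half-plane [v.1 <= 1]. *)
Definition west :=
  Side (1, 0) 6 (thresholds (fun a _ => if (a <= 1)%N then Posz a else Posz a - 6))
    (rect (-2) 2 (-1) 1) (0, 1) (-6, 0).

Definition north :=
  Side (0, 1) 3 (thresholds (fun _ b => if (b <= 1)%N then Posz b else Posz b - 3))
    (rect (-1) 1 (-2) 2) (1, 0) (0, -3).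

(* Half-planes with y below the boundary line are not self-forcing, hence a triangular hole with an
   oblique third side; that side has to leave out the outermost cells of phase (2, 1). *)
Definition slant :=
  Side (-1, -1) 3
    (thresholds (fun a b => if (a == 2%N) && (b == 1%N) then -3 else - ((Posz (a + b)) %% 3)%Z))
    (rect (-2) 2 (-2) 2) (1, -1) (0, 3).

Lemma west_ok : well_formed west && self_forcing west.
Proof. by vm_compute. Qed.

Lemma north_ok : well_formed north && self_forcing north.
Proof. by vm_compute. Qed.

Lemma slant_ok : well_formed slant && self_forcing slant.
Proof. by vm_compute. Qed.

Section SideSoundness.

Variable s : side.

Definition on_line (l : int) x (k : nat) v : Prop :=
  [/\ height s v = l, forall w, inside s w -> life x w = agar w
    & forall w, inside s w -> height s w < l -> x w = agar w].

Lemma withinP l v w : height s v = l ->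
  within s (l + height s w) (phase (rep (phase v) + w)) = inside s (v + w).
Proof. by move=> <-; rewrite -heightD -phaseD. Qed.

Lemma has_letter b : has_word (letter b) [:: b].
Proof. by case: b. Qed.

Lemma has_constrain l x k v known tr V lks t (W := window s) :
  on_line l x k v -> {subset lks <= links W V W} ->
  (forall w, inside s w -> known ==> (height s w < l) -> has_word (tr (agar w)) (read x w V)) ->
  has_word t (read x v W) ->
  has_word (foldl (constrain s l (phase v) known tr) t lks) (read x v W).
Proof.
case=> hv _ _ + htr; elim: lks t => //= lk lks IHlks t sub ht.
apply: IHlks => [i ijs|]; first by apply: sub; rewrite inE ijs orbT.
have /mapP[w] := sub _ (mem_head _ _); rewrite mem_filter => /andP[al _] -> {lk sub}.
rewrite /constrain /= withinP //; case: ifP => // /andP[ins kn].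
by apply: has_cut => //; rewrite -phaseD; apply: htr; rewrite ?heightD ?hv.
Qed.

Lemma has_seed l x k v (W := window s) : on_line l x k v ->
  has_word (seed s (links W [:: 0] W) (links W block3 W) l (phase v)) (read x v W).
Proof.
move=> hl; have [_ hlife hx] := hl.
apply: (has_constrain (V := block3) hl) => // [w ins _|].
  by rewrite -hlife //; apply: has_blocks.
apply: (has_constrain (V := [:: 0]) hl) => // w ins lt.
by rewrite /read /= addr0 hx ?has_letter.
Qed.

Hypotheses (wf : well_formed s) (sf : self_forcing s).

Lemma height_rep v : (Posz (period s) %| height s v - height s (rep (phase v)))%Z.
Proof.
have repE : rep (phase v) = ((v.1 %% 6)%Z, (v.2 %% 3)%Z).
  by rewrite /rep /phase; congr (_, _); lia.
case/and5P: wf => _ _ _ _ /and5P[_ _ + + _]; rewrite repE /height /=.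
case: (slope s) => a b /= dvda dvdb.
rewrite {1}(divz_eq v.1 6) {1}(divz_eq v.2 3).
set q1 := (v.1 %/ 6)%Z; set q2 := (v.2 %/ 3)%Z.
have -> : a * (q1 * 6 + (v.1 %% 6)%Z) + b * (q2 * 3 + (v.2 %% 3)%Z) -
   (a * (v.1 %% 6)%Z + b * (v.2 %% 3)%Z) = 6 * a * q1 + 3 * b * q2 by lia.
by apply: rpredD; apply: dvdz_mulr; rewrite dvdzE abszM.
Qed.

Lemma line_forced l x v :
  on_line l x 0 v -> nth 0 (threshold s) (phase v) = l -> x v = agar v.
Proof.
move=> hl thE; have [hv _ _] := hl.
case/and5P: wf => /eqP sizeth _ /allP thP _ /and5P[_ _ _ _ /and4P[/eqP hal /eqP hin _ _]].
have line_p : phase v \in online s l.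
  rewrite mem_filter mem_phases andbT; apply/eqP/dvdz_mod0P.
  rewrite -hv -opprB rpredN; exact: height_rep.
have [k hk] : exists k, admits (on_line l) (window s)
    (line s (links (window s) [:: 0] (window s)) (links (window s) block3 (window s)) l) k.
  apply: admits_sweeps => [//|y k w u us [hw h1 h2]|].
    split=> //; rewrite heightD hw; move: us.
    by rewrite !inE => /orP[]/eqP->; rewrite ?heightN hal ?oppr0 addr0.
  exists 0%N => y w hw; rewrite (nth_map 0%N) ?size_iota ?phase_lt // nth_iota ?phase_lt // add0n.
  case: ifP => // _; exact: has_seed hw.
apply: forcesP hk hl _.
move/allP: sf => /(_ l); rewrite mem_undup -{1}thE mem_nth ?sizeth ?phase_lt // => /(_ isT)/allP.
by move/(_ _ line_p); rewrite thE eqxx.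
Qed.

Lemma inside_period u v : (u.1 %% 6)%Z = 0 -> (u.2 %% 3)%Z = 0 -> height s u <= 0 ->
  inside s v -> inside s (v + u).
Proof. by move=> u1 u2 hu; rewrite /inside phase_period // heightD /within; lia. Qed.

Lemma agar_period u v : (u.1 %% 6)%Z = 0 -> (u.2 %% 3)%Z = 0 -> agar (v + u) = agar v.
Proof. by move=> u1 u2; rewrite /agar phase_period. Qed.

Lemma threshold_bound p : `|nth 0 (threshold s) p| <= 10.
Proof.
case: (ltnP p (size (threshold s))) => hp; last by rewrite nth_default.
by case/and5P: wf => _ /(all_nthP 0)/(_ p hp).
Qed.

(** Induction on the height: deep cells are settled by [agar_forced], the others by [line_forced]
    once all lower cells are known. *)
Lemma half_plane x : (forall v, inside s v -> life x v = agar v) ->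
  forall v, inside s v -> x v = agar v.
Proof.
move=> hx; have [k hk] := agar_forced.
(* Thresholds are at least -10, and a move of at most [k] in each coordinate changes the height by
   at most [2 * k]. *)
suff main (n : nat) v : inside s v -> height s v <= Posz n - Posz (10 + 2 * k)%N -> x v = agar v.
  move=> v hv; apply: (main (absz (height s v + Posz (10 + 2 * k)%N)) v hv); lia.
elim: n v => [|n IHn] v hv hn.
  apply: hk => u u1 u2; apply: hx.
  have := threshold_bound (phase (v + u)).
  case/and5P: wf => _ _ _ s1 /and5P[s2 _ _ _ _].
  rewrite /inside /within heightD; move: hn s1 s2; rewrite /height.
  case: (slope s) u u1 u2 => a b [c d] /= u1 u2 hn s1 s2 hth.
  have := leq_mul s1 u1; have := leq_mul s2 u2; rewrite -!abszM !mul1n.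
  lia.
have [/IHn|hgt] := boolP (height s v <= Posz n - Posz (10 + 2 * k)%N); first exact.
set l := nth 0 (threshold s) (phase v).
have lv : height s v <= l by [].
case/and5P: wf => _ _ /allP/(_ (phase v)) thP _ /and5P[_ p0 _ _ /and4P[_ /eqP hin /eqP i1 /eqP i2]].
have dl : (Posz (period s) %| l - height s v)%Z.
  have /eqP/dvdz_mod0P := thP (mem_phases v).
  move=> h; rewrite -rpredN opprB.
  have -> : height s v - l =
      (height s v - height s (rep (phase v))) + (height s (rep (phase v)) - l).
    by rewrite addrA subrK.
  by apply: rpredD; rewrite ?height_rep.
have [m mE] : exists m : nat, l - height s v = Posz m * Posz (period s).
  by case/dvdzP: dl => -[m|m] mE; [exists m|exists 0%N]; move: mE; nia.
(* A multiple of [inward]: pulling [x] back along [t] places [v] at its threshold, and adding [t]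
   keeps inside cells inside. *)
pose t : point := ((inward s).1 * m, (inward s).2 * m).
have [t1 t2 ht] : [/\ (t.1 %% 6)%Z = 0, (t.2 %% 3)%Z = 0 & height s t = height s v - l].
  split; [by rewrite -modzMml i1 mul0r mod0z|by rewrite -modzMml i2 mul0r mod0z|].
  have -> : height s t = height s (inward s) * m.
    by rewrite {1}/height /t /= !mulrA -mulrDl.
  by rewrite hin mulNr mulrC -mE opprB.
pose y u := x (u + t).
have -> : x v = y (v - t) by rewrite /y subrK.
have -> : agar v = agar (v - t) by rewrite -[in LHS](subrK t v) (agar_period _ t1 t2).
have phv : phase (v - t) = phase v by rewrite -[in RHS](subrK t v) (phase_period _ t1 t2).
have hvt : height s (v - t) = l.
  have := heightD s (v - t) t; rewrite subrK ht; lia.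
apply: (@line_forced l); last by rewrite phv.
split=> // [w hw|w hw lt].
  by rewrite /y life_shift hx ?agar_period //; apply: inside_period => //; lia.
rewrite /y IHn ?agar_period //; first by apply: inside_period => //; lia.
by rewrite heightD ht; lia.
Qed.

End SideSoundness.

Lemma half_plane_shift s w x : well_formed s -> self_forcing s ->
  (w.1 %% 6)%Z = 0 -> (w.2 %% 3)%Z = 0 ->
  (forall v, inside s (v + w) -> life x v = agar v) ->
  forall v, inside s (v + w) -> x v = agar v.
Proof.
move=> wf sf w1 w2 hx v hv.
have E u : agar (u - w) = agar u by rewrite -[in RHS](subrK w u) (agar_period _ w1 w2).
rewrite -[v](addrK w) E; apply: (half_plane wf sf (x := fun u => x (u - w)) _ hv) => u hu.
by rewrite life_shift hx ?subrK.
Qed.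

(** * Triangular holes in the agar *)

(* The complement of a triangular hole. *)
Definition around (n : nat) v : bool :=
  [|| inside west (v + (Posz (6 * n), 0)), inside north (v + (0, Posz (6 * n)))
    | inside slant (v - (Posz (6 * n), Posz (6 * n)))].

Lemma around_forced n x : (forall v, around n v -> life x v = agar v) ->
  forall v, around n v -> x v = agar v.
Proof.
have [ww wf] := andP west_ok; have [nw nf] := andP north_ok; have [sw sf] := andP slant_ok.
move=> hx v /or3P[] hv.
- apply: (half_plane_shift ww wf _ _ _ hv) => [||u hu]; [by rewrite /=; lia|by []|].
  exact/hx/or3P/Or31.
- apply: (half_plane_shift nw nf _ _ _ hv) => [||u hu]; [by []|by rewrite /=; lia|].
  exact/hx/or3P/Or32.
- apply: (half_plane_shift sw sf _ _ _ hv) => [||u hu]; [by rewrite /=; lia|by rewrite /=; lia|].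
  exact/hx/or3P/Or33.
Qed.

Lemma around_far n v : around n v -> (6 * n <= maxn `|v.1| `|v.2| + 10)%N.
Proof.
have [lw _] := andP west_ok; have [tw _] := andP north_ok; have [dw _] := andP slant_ok.
case: v => a b; case/or3P; rewrite /inside /within; set p := phase _.
- by have := threshold_bound lw p; rewrite /height /=; lia.
- by have := threshold_bound tw p; rewrite /height /=; lia.
- by have := threshold_bound dw p; rewrite /height /=; lia.
Qed.

(** Up to thresholds, the sides are [v.1 = -6n], [v.2 = -6n] and [v.1 + v.2 = 12n], with corners of
    norm at most 18n. Two threshold errors of 10 give 20. *)
Lemma hole_bounded n v : ~~ around n v -> (maxn `|v.1| `|v.2| <= 18 * n + 20)%N.
Proof.
have [lw _] := andP west_ok; have [tw _] := andP north_ok; have [dw _] := andP slant_ok.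
case: v => a b; rewrite !negb_or => /and3P[]; rewrite /inside /within.
set p := phase _; set q := phase _; set r := phase _.
have := threshold_bound lw p; have := threshold_bound tw q; have := threshold_bound dw r.
by rewrite /height /=; lia.
Qed.

(** * Locality, diagonal segments and patches *)

Lemma life_local k x y v :
  (forall u, (`|u.1| <= k)%N -> (`|u.2| <= k)%N -> x (v + u) = y (v + u)) ->
  iter k life x v = iter k life y v.
Proof.
elim: k v => [|k IHk] v h /=; first by have := h 0; rewrite addr0; apply.
have step w : w \in block3 -> iter k life x (v + w) = iter k life y (v + w).
  move=> w3; have /andP[w1 w2] : (`|w.1| <= 1)%N && (`|w.2| <= 1)%N.
    by move: w w3; apply/allP.
  by apply: IHk => u u1 u2; rewrite -addrA; apply: h => /=; lia.
by rewrite !lifeE; congr rule; apply/eq_in_map; apply: step.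
Qed.

Definition segment (m : nat) : config := fun v => (v.1 == v.2) && (`|v.1| <= m)%N.

Definition dead : config := fun=> false.

Lemma life_dead : life dead = dead.
Proof. by apply/funext => v; rewrite lifeE. Qed.

(** Interior cells have two live neighbours and survive, end cells have at most one and die. A dead
    cell never sees more than two live cells. *)
Lemma life_segmentE m v :
  life (segment m) v = (v.1 == v.2) && ((absz (v.1 - 1)%R <= m) && (absz (v.1 + 1)%R <= m))%N.
Proof.
rewrite lifeE; case: v => a b.
pose z (c : int) : bool := b - a == c; pose t (c : int) := (absz (a + c)%R <= m)%N.
have -> : read (segment m) (a, b) block3 =
    [:: z 0 && t (-1); z (-1) && t (-1); z (-2) && t (-1); z 1 && t 0; z 0 && t 0;
        z (-1) && t 0; z 2 && t 1; z 1 && t 1; z 0 && t 1].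
  by rewrite /read /segment /z /t /=; congr [:: _; _; _; _; _; _; _; _; _]; lia.
have -> : (a == b) && ((absz (a - 1)%R <= m) && (absz (a + 1)%R <= m))%N = z 0 && (t (-1) && t 1).
  by rewrite /z /t; lia.
have : t (-1) && t 1 ==> t 0 by rewrite /t; lia.
have : (z (-2)%R + z (-1)%R + z 0%R + z 1%R + z 2%R <= 1)%N by rewrite /z; lia.
by case: (z (-2)) (z (-1)) (z 0) (z 1) (z 2) (t (-1)) (t 0) (t 1)
  => [] [] [] [] [] [] [] [].
Qed.

Lemma life_segment m : life (segment m.+1) = segment m.
Proof. by apply/funext => v; rewrite life_segmentE /segment; lia. Qed.

Lemma life_segment0 : life (segment 0) = dead.
Proof. by apply/funext => v; rewrite life_segmentE /dead; lia. Qed.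

Lemma iter_segment k m : iter k life (segment (k + m)) = segment m.
Proof. by elim: k m => //= k IHk m; rewrite addSnnS IHk life_segment. Qed.

Lemma iter_dead k : iter k life dead = dead.
Proof. by elim: k => //= k ->; apply: life_dead. Qed.

Lemma iter_agar k : iter k life agar = agar.
Proof. by elim: k => //= k ->; apply: life_agar. Qed.

Definition patch (r : nat) x : config :=
  fun v => if (maxn `|v.1| `|v.2| <= r)%N then x v else agar v.

Lemma patch_inside r k x v : (maxn `|v.1| `|v.2| + k <= r)%N ->
  iter k life (patch r x) v = iter k life x v.
Proof.
move=> h; apply: life_local => u u1 u2; rewrite /patch /=.
by case: ifP => // /negP[]; lia.
Qed.

Lemma patch_outside r k x v : (r + k < maxn `|v.1| `|v.2|)%N ->
  iter k life (patch r x) v = agar v.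
Proof.
move=> h; rewrite -[agar in RHS](iter_agar k); apply: life_local => u u1 u2.
by rewrite /patch /=; case: ifP => //; lia.
Qed.

Lemma patch_merge n (r := (3 * n + 3)%N) :
  iter n.+1 life (patch r (segment n)) = iter n.+1 life (patch r dead).
Proof.
apply/funext => v; case: (leqP (maxn `|v.1| `|v.2| + n.+1)%N r) => hv.
  by rewrite !patch_inside // iter_dead iterS -[n in segment n]addn0 iter_segment life_segment0.
(* Here [v] has norm above 2n + 2, so within n + 1 cells it only sees cells off the segment. *)
apply: life_local => u u1 u2; rewrite /patch; case: ifP => // hr.
by rewrite /segment /dead /=; lia.
Qed.

Lemma patch_differ n (r := (3 * n + 3)%N) :
  iter n life (patch r (segment n)) <> iter n life (patch r dead).
Proof.
move=> /(congr1 (fun x => x 0)); rewrite !patch_inside; try by rewrite /r /=; lia.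
by rewrite iter_dead -[n in segment n]addn0 iter_segment.
Qed.

(** * Finiteness, periodicity and the conclusion *)

(* By the first hypothesis [F] is finite, so every backward orbit in it visits some point twice. *)
Lemma backward_periodic (m : nat) (F : config -> Prop) :
  (forall x y, F x -> F y -> (forall v, (maxn `|v.1| `|v.2| <= m)%N -> x v = y v) -> x = y) ->
  (forall x, F x -> exists2 y, F y & life y = x) ->
  forall x, F x -> exists2 k, (0 < k)%N & iter k life x = x.
Proof.
move=> Fext Fpre x Fx.
have [pre preP] : exists pre : config -> config, forall y, F y -> F (pre y) /\ life (pre y) = y.
  have /choice[pre preP] : forall y, exists z, F y -> F z /\ life z = y.
    by move=> y; have [/Fpre[z]|] := pselect (F y); [exists z|exists y].
  by exists pre.
pose b k := iter k pre x.
have Fb k : F (b k) by elim: k => //= k /preP[].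
have iterb i j : iter i life (b (i + j)%N) = b j.
  by elim: i => // i IHi; rewrite iterSr addSn /= (preP _ (Fb _)).2.
pose D := 'I_m.*2.+1; pose at_ (i : D) : int := Posz i - Posz m.
(* Points of [F] are determined by their values on this box, so one index more than there are codes
   forces a repetition. *)
pose code k := [ffun ij : D * D => b k (at_ ij.1, at_ ij.2)].
have : ~~ injectiveb (fun k : 'I_(#|{ffun D * D -> bool}|.+1) => code k).
  by apply/negP => /injectiveP/leq_card; rewrite card_ord ltnn.
case/injectivePn => i [j neq_ij eq_ij].
have eqb : b i = b j.
  apply: Fext => // -[v1 v2] /= hv.
  have h1 : (absz (v1 + Posz m)%R < m.*2.+1)%N by lia.
  have h2 : (absz (v2 + Posz m)%R < m.*2.+1)%N by lia.
  have := congr1 (fun f : {ffun _} => f (Ordinal h1, Ordinal h2)) eq_ij; rewrite !ffunE /=.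
  have -> : at_ (Ordinal h1) = v1 by rewrite /at_ /=; lia.
  by have -> : at_ (Ordinal h2) = v2 by rewrite /at_ /=; lia.
wlog lt_ij : i j neq_ij {eq_ij} eqb / (i < j)%N.
  move=> H; have [lt|gt|eq] := ltngtP i j; first exact: (H i j).
    by apply: (H j i) => //; rewrite eq_sym.
  by rewrite (val_inj eq) eqxx in neq_ij.
exists (j - i)%N; first by rewrite subn_gt0.
(* Applying [life] [i] times to [b i = b j] gives [b 0 = b (j - i)]. *)
have xE : x = b (j - i)%N.
  rewrite -[x]/(b 0%N) -(iterb i 0%N) addn0 eqb -[nat_of_ord j](subnKC (ltnW lt_ij)).
  by rewrite iterb subnKC // ltnW.
by rewrite {1}xE -[in b _](addn0 (j - i)%N) iterb.
Qed.

Lemma depth_exists n : exists2 x, (exists y, iter n life y = x)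
  & forall y, iter n.+1 life y <> x.
Proof.
apply: contrapT => none.
have deeper y : exists z, iter n.+1 life z = iter n life y.
  apply: contrapT => nz; apply: none; exists (iter n life y); first by exists y.
  by move=> z zE; apply: nz; exists z.
(* The choice of [N] gives [6 * N - 10 > r + n]: in [n] steps the patch cannot affect any cell
   outside the hole. *)
pose r := (3 * n + 3)%N; pose N := (r + n + 2)%N.
pose F x := (exists y, iter n life y = x) /\ forall v, around N v -> x v = agar v.
have Fperiodic x : F x -> exists2 k, (0 < k)%N & iter k life x = x.
  apply: (@backward_periodic (18 * N + 20)%N F) => {x} [x y [_ hx] [_ hy] xy|x [[y <-] hx]].
    apply/funext => v; have [av|nav] := boolP (around N v); first by rewrite hx ?hy.
    exact/xy/hole_bounded.
  have [z zE] := deeper y; exists (iter n life z); last by rewrite -zE.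
  split; first by exists z.
  by apply: around_forced => v /hx; rewrite -zE.
have FP x : F (iter n life (patch r x)).
  split=> [|v /around_far far]; first by exists (patch r x).
  by apply: patch_outside; rewrite /N /r in far *; lia.
have [p p0 pE] := Fperiodic _ (FP (segment n)).
have [q q0 qE] := Fperiodic _ (FP dead).
have eq_life : life (iter n life (patch r (segment n))) = life (iter n life (patch r dead)).
  exact: patch_merge.
apply: (@patch_differ n); rewrite -/r.
(* Both configurations are fixed by [p * q > 0] iterations and have the same image under [life], so
   they are equal. *)
rewrite -(iter_fix q pE) -[RHS](iter_fix p qE) -!iterM [(q * p)%N]mulnC.
by rewrite -(prednK (_ : 0 < p * q)%N) ?muln_gt0 ?p0 // !iterSr eq_life.
Qed.

End GameOfLife.

Local Open Scope classical_set_scope.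

Theorem theorem1 (n : nat) :
  exists x : config,
    iter n life @^-1` [set x] !=set0 /\ iter n.+1 life @^-1` [set x] = set0.
Proof.
have [x [y yE] hx] := depth_exists n.
exists x; split; first by exists y.
by apply/seteqP; split=> // z /hx.
Qed.
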